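(* Any two derived images of a right Quillen functor are equivalent as categories. Dually, any two derived coimages of a left Quillen functor are equivalent as categories.
   Context: For a Quillen adjunction $F:\mathcal E\rightleftarrows\mathcal E':G$ ($F$ left adjoint): the homotopy-unit at a cofibrant object $X$ of $\mathcal E$ is the map $X\to G(f(F(X)))$ adjoint to a fibrant replacement $F(X)\to f(F(X))$; the homotopy-counit at a fibrant object $Y$ of $\mathcal E'$ is the map $F(c(G(Y)))\to Y$ adjoint to a cofibrant replacement $c(G(Y))\to G(Y)$. The right Quillen functor $G$ is a homotopy-coreflection if all homotopy-units are weak equivalences; the left Quillen functor $F$ is a homotopy-reflection if all homotopy-counits are weak equivalences. A right Quillen functor $G:\mathcal E'\to\mathcal E$ is homotopy-right-conservative if a morphism $g$ between fibrant objects of $\mathcal E'$ is a weak equivalence if and only if $G(g)$ is. A left Quillen functor $F:\mathcal E\to\mathcal E'$ is homotopy-left-conservative if a morphism $f$ between cofibrant objects of $\mathcal E$ is a weak equivalence if and only if $F(f)$ is. A derived image of a right Quillen functor $G:\mathcal E'\to\mathcal E$ is the homotopy category $\mathbf{Ho}(\mathcal M)$ associated to any factorisation of $G$ into a homotopy-coreflection $\mathcal E'\to\mathcal M$ followed by a homotopy-right-conservative (right Quillen) functor $\mathcal M\to\mathcal E$. Dually, a derived coimage of a left Quillen functor $F$ is the homotopy category $\mathbf{Ho}(\mathcal M)$ associated to any factorisation of $F$ into a homotopy-reflection (with target $\mathcal M$) followed by a homotopy-left-conservative (left Quillen) functor. *)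

(* Defs.v *)
From HB Require Import structures.
From mathcomp Require Import all_boot generic_quotient.
From mathcomp Require Import boolp classical_sets functions cardinality.

Set Implicit Arguments.
Unset Strict Implicit.
Unset Printing Implicit Defensive.

Declare Scope cat_scope.
Delimit Scope cat_scope with cat.
Local Open Scope quotient_scope.
Local Open Scope cat_scope.

(** * Categories, functors, adjunctions, equivalences *)

Record category := Category {
  obj :> Type;
  hom : obj -> obj -> Type;
  idc : forall X, hom X X;
  compc : forall X Y Z, hom Y Z -> hom X Y -> hom X Z;
  compc1 : forall X Y (f : hom X Y), compc f (idc X) = f;
  comp1c : forall X Y (f : hom X Y), compc (idc Y) f = f;
  compcA : forall X Y Z T (h : hom Z T) (g : hom Y Z) (f : hom X Y),
    compc h (compc g f) = compc (compc h g) f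
}.

Arguments hom {c} X Y.
Arguments idc {c} X.
Arguments compc {c X Y Z} g f.
Notation "g ∘ f" := (compc g f) (at level 40, left associativity) : cat_scope.

Definition is_iso (C : category) (X Y : C) (f : hom X Y) : Prop :=
  exists g : hom Y X, g ∘ f = idc X /\ f ∘ g = idc Y.

Record functor (C D : category) := Functor {
  fobj :> C -> D;
  fmap : forall X Y : C, hom X Y -> hom (fobj X) (fobj Y);
  fmap1 : forall X : C, fmap (idc X) = idc (fobj X);
  fmapM : forall (X Y Z : C) (g : hom Y Z) (f : hom X Y),
    fmap (g ∘ f) = fmap g ∘ fmap f
}.

Arguments fmap {C D} F {X Y} f : rename.

Definition id_functor (C : category) : functor C C :=
  @Functor C C (fun X => X) (fun X Y f => f) (fun=> erefl) (fun _ _ _ _ _ => erefl).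

Section CompFunctor.
Variables (C D E : category) (G : functor D E) (F : functor C D).

Lemma comp_functor_fmap1 (X : C) : fmap G (fmap F (idc X)) = idc (G (F X)).
Proof. by rewrite !fmap1. Qed.

Lemma comp_functor_fmapM (X Y Z : C) (g : hom Y Z) (f : hom X Y) :
  fmap G (fmap F (g ∘ f)) = fmap G (fmap F g) ∘ fmap G (fmap F f).
Proof. by rewrite !fmapM. Qed.

Definition comp_functor : functor C E :=
  @Functor C E (fun X => G (F X)) (fun X Y f => fmap G (fmap F f))
    comp_functor_fmap1 comp_functor_fmapM.

End CompFunctor.

Definition naturally_isomorphic (C D : category) (F G : functor C D) : Prop :=
  exists t : forall X : C, hom (F X) (G X),
    (forall (X Y : C) (f : hom X Y), t Y ∘ fmap F f = fmap G f ∘ t X) /\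
    (forall X : C, is_iso (t X)).

Definition equivalent_categories (C D : category) : Prop :=
  exists (F : functor C D) (G : functor D C),
    naturally_isomorphic (comp_functor G F) (id_functor C) /\
    naturally_isomorphic (comp_functor F G) (id_functor D).

Record adjunction (C D : category) (F : functor C D) (G : functor D C) :=
  Adjunction {
    adj : forall (X : C) (Y : D), hom (F X) Y -> hom X (G Y);
    adj_inv : forall (X : C) (Y : D), hom X (G Y) -> hom (F X) Y;
    adjK : forall (X : C) (Y : D) (f : hom (F X) Y), adj_inv (adj f) = f;
    adj_invK : forall (X : C) (Y : D) (g : hom X (G Y)), adj (adj_inv g) = g;
    adj_natural : forall (X X' : C) (Y Y' : D)
      (h : hom X' X) (f : hom (F X) Y) (k : hom Y Y'),
      adj (k ∘ f ∘ fmap F h) = fmap G k ∘ adj f ∘ h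
  }.

Arguments adj {C D F G} a {X Y} f : rename.
Arguments adj_inv {C D F G} a {X Y} g : rename.

(** * Finite limits and colimits *)

Definition finite_category (J : category) : Prop :=
  finite_set [set: J] /\ forall i j : J, finite_set [set: hom i j].

Section Limits.
Variables (J C : category) (D : functor J C).

Definition is_cone (c : C) (p : forall j : J, hom c (D j)) : Prop :=
  forall (i j : J) (u : hom i j), fmap D u ∘ p i = p j.

Definition is_cocone (c : C) (q : forall j : J, hom (D j) c) : Prop :=
  forall (i j : J) (u : hom i j), q j ∘ fmap D u = q i.

Definition has_limit : Prop :=
  exists (c : C) (p : forall j : J, hom c (D j)), is_cone p /\
    forall (d : C) (p' : forall j : J, hom d (D j)), is_cone p' ->
      exists! h : hom d c, forall j, p j ∘ h = p' j.

Definition has_colimit : Prop :=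
  exists (c : C) (q : forall j : J, hom (D j) c), is_cocone q /\
    forall (d : C) (q' : forall j : J, hom (D j) d), is_cocone q' ->
      exists! h : hom c d, forall j, h ∘ q j = q' j.

End Limits.

Definition has_finite_limits (C : category) : Prop :=
  forall (J : category) (D : functor J C), finite_category J -> has_limit D.

Definition has_finite_colimits (C : category) : Prop :=
  forall (J : category) (D : functor J C), finite_category J -> has_colimit D.

Definition is_initial (C : category) (I : C) : Prop :=
  forall X : C, exists! f : hom I X, True.

Definition is_terminal (C : category) (T : C) : Prop :=
  forall X : C, exists! f : hom X T, True.

(** * Model categories *)

Definition morphism_class (C : category) := forall X Y : C, hom X Y -> Prop.

Definition is_retract (C : category) (X Y X' Y' : C)
    (f : hom X Y) (g : hom X' Y') : Prop :=
  exists (i : hom X X') (r : hom X' X) (j : hom Y Y') (s : hom Y' Y),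
    [/\ r ∘ i = idc X, s ∘ j = idc Y, g ∘ i = j ∘ f & f ∘ r = s ∘ g].

Definition retract_closed (C : category) (P : morphism_class C) : Prop :=
  forall (X Y X' Y' : C) (f : hom X Y) (g : hom X' Y'),
    is_retract f g -> P _ _ g -> P _ _ f.

Definition two_out_of_three (C : category) (P : morphism_class C) : Prop :=
  forall (X Y Z : C) (f : hom X Y) (g : hom Y Z),
    [/\ P _ _ f -> P _ _ g -> P _ _ (g ∘ f),
        P _ _ f -> P _ _ (g ∘ f) -> P _ _ g
      & P _ _ g -> P _ _ (g ∘ f) -> P _ _ f].

Definition has_lifting (C : category) (A B X Y : C)
    (i : hom A B) (p : hom X Y) : Prop :=
  forall (u : hom A X) (v : hom B Y), p ∘ u = v ∘ i ->
    exists h : hom B X, h ∘ i = u /\ p ∘ h = v.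

(* Quillen's axioms: finite limits and colimits, and factorisations that need
   not be functorial.  *)
Record model_category := ModelCategory {
  mcat :> category;
  weq : morphism_class mcat;
  cof : morphism_class mcat;
  fib : morphism_class mcat;
  model_limits : has_finite_limits mcat;
  model_colimits : has_finite_colimits mcat;
  weq_two_out_of_three : two_out_of_three weq;
  weq_retract : retract_closed weq;
  cof_retract : retract_closed cof;
  fib_retract : retract_closed fib;
  lift_acyclic_cof : forall (A B X Y : mcat) (i : hom A B) (p : hom X Y),
    cof i -> weq i -> fib p -> has_lifting i p;
  lift_acyclic_fib : forall (A B X Y : mcat) (i : hom A B) (p : hom X Y),
    cof i -> fib p -> weq p -> has_lifting i p;
  factor_acyclic_cof : forall (X Y : mcat) (f : hom X Y),
    exists (Z : mcat) (i : hom X Z) (p : hom Z Y),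
      [/\ cof i, weq i, fib p & p ∘ i = f];
  factor_acyclic_fib : forall (X Y : mcat) (f : hom X Y),
    exists (Z : mcat) (i : hom X Z) (p : hom Z Y),
      [/\ cof i, fib p, weq p & p ∘ i = f]
}.

Arguments weq {m X Y} f : rename.
Arguments cof {m X Y} f : rename.
Arguments fib {m X Y} f : rename.

Definition cofibrant (M : model_category) (X : M) : Prop :=
  exists (I : M) (f : hom I X), is_initial I /\ cof f.

Definition fibrant (M : model_category) (X : M) : Prop :=
  exists (T : M) (f : hom X T), is_terminal T /\ fib f.

Definition fibrant_replacement (M : model_category) (X X' : M)
    (r : hom X X') : Prop :=
  [/\ fibrant X', cof r & weq r].

Definition cofibrant_replacement (M : model_category) (X X' : M)
    (q : hom X' X) : Prop :=
  [/\ cofibrant X', fib q & weq q].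

(** * The homotopy category *)

Section HomotopyCategory.
Variable M : model_category.

(* [Ho M] is the localisation of [M] at its weak equivalences, presented by
   generators (the morphisms of [M] and formal inverses of the weak
   equivalences) and relations.  *)
Inductive word : M -> M -> Type :=
| word_id (X : M) : word X X
| word_map (X Y : M) (f : hom X Y) : word X Y
| word_inv (X Y : M) (w : hom X Y) (weq_w : weq w) : word Y X
| word_comp (X Y Z : M) (q : word Y Z) (p : word X Y) : word X Z.

Inductive word_eq : forall X Y : M, word X Y -> word X Y -> Prop :=
| word_eq_refl X Y (p : word X Y) : word_eq p p
| word_eq_sym X Y (p q : word X Y) : word_eq p q -> word_eq q p
| word_eq_trans X Y (p q r : word X Y) :
    word_eq p q -> word_eq q r -> word_eq p r
| word_eq_comp X Y Z (q q' : word Y Z) (p p' : word X Y) :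
    word_eq q q' -> word_eq p p' ->
    word_eq (word_comp q p) (word_comp q' p')
| word_eq_comp1 X Y (p : word X Y) : word_eq (word_comp p (word_id X)) p
| word_eq_1comp X Y (p : word X Y) : word_eq (word_comp (word_id Y) p) p
| word_eq_compA X Y Z T (r : word Z T) (q : word Y Z) (p : word X Y) :
    word_eq (word_comp r (word_comp q p)) (word_comp (word_comp r q) p)
| word_eq_map1 X : word_eq (word_map (idc X)) (word_id X)
| word_eq_mapM X Y Z (g : hom Y Z) (f : hom X Y) :
    word_eq (word_map (g ∘ f)) (word_comp (word_map g) (word_map f))
| word_eq_mapV X Y (w : hom X Y) (weq_w : weq w) :
    word_eq (word_comp (word_map w) (word_inv weq_w)) (word_id Y)
| word_eq_Vmap X Y (w : hom X Y) (weq_w : weq w) :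
    word_eq (word_comp (word_inv weq_w) (word_map w)) (word_id X).

Section WordQuotient.
Variables X Y : M.

Definition word_rel : rel {classic word X Y} := fun p q => `[< word_eq p q >].

Lemma word_rel_refl : reflexive word_rel.
Proof. by move=> p; apply/asboolP; apply: word_eq_refl. Qed.

Lemma word_rel_sym : symmetric word_rel.
Proof. by move=> p q; apply: asbool_equiv_eq; split; apply: word_eq_sym. Qed.

Lemma word_rel_trans : transitive word_rel.
Proof.
by move=> q p r /asboolP pq /asboolP qr; apply/asboolP; apply: word_eq_trans pq qr.
Qed.

Canonical word_equiv := EquivRel word_rel word_rel_refl word_rel_sym word_rel_trans.

Definition ho_hom : Type := {eq_quot word_equiv}.

Definition word_class (p : word X Y) : ho_hom :=
  \pi_({eq_quot word_equiv}) (p : {classic word X Y}).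

Definition word_repr (a : ho_hom) : word X Y :=
  repr (a : {eq_quot word_equiv}).

Lemma word_classP (p q : word X Y) : word_class p = word_class q <-> word_eq p q.
Proof.
split=> [/(@eqmodP _ word_equiv)/asboolP //|pq].
by apply/(@eqmodP _ word_equiv)/asboolP.
Qed.

Lemma word_reprK (a : ho_hom) : word_class (word_repr a) = a.
Proof. exact: reprK. Qed.

Lemma word_classK (p : word X Y) : word_eq (word_repr (word_class p)) p.
Proof. by apply/word_classP; rewrite word_reprK. Qed.

End WordQuotient.

Definition ho_id (X : M) : ho_hom X X := word_class (word_id X).

Definition ho_comp (X Y Z : M) (b : ho_hom Y Z) (a : ho_hom X Y) : ho_hom X Z :=
  word_class (word_comp (word_repr b) (word_repr a)).

Lemma ho_compE (X Y Z : M) (q : word Y Z) (p : word X Y) :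
  ho_comp (word_class q) (word_class p) = word_class (word_comp q p).
Proof. by apply/word_classP; apply: word_eq_comp; apply: word_classK. Qed.

Lemma ho_comp1 (X Y : M) (a : ho_hom X Y) : ho_comp a (ho_id X) = a.
Proof.
by rewrite -(word_reprK a) ho_compE; apply/word_classP; apply: word_eq_comp1.
Qed.

Lemma ho_1comp (X Y : M) (a : ho_hom X Y) : ho_comp (ho_id Y) a = a.
Proof.
by rewrite -(word_reprK a) ho_compE; apply/word_classP; apply: word_eq_1comp.
Qed.

Lemma ho_compA (X Y Z T : M) (c : ho_hom Z T) (b : ho_hom Y Z) (a : ho_hom X Y) :
  ho_comp c (ho_comp b a) = ho_comp (ho_comp c b) a.
Proof.
rewrite -(word_reprK a) -(word_reprK b) -(word_reprK c) !ho_compE.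
by apply/word_classP; apply: word_eq_compA.
Qed.

Definition Ho : category :=
  @Category M ho_hom ho_id ho_comp ho_comp1 ho_1comp ho_compA.

End HomotopyCategory.

(** * Quillen adjunctions *)

Section Quillen.
Variables (E E' : model_category).

Definition quillen_adjunction (F : functor E E') (G : functor E' E)
    (a : adjunction F G) : Prop :=
  (forall (X Y : E) (f : hom X Y), cof f -> cof (fmap F f)) /\
  (forall (X Y : E') (g : hom X Y), fib g -> fib (fmap G g)).

Definition left_quillen (F : functor E E') : Prop :=
  exists (G : functor E' E) (a : adjunction F G), quillen_adjunction a.

Definition right_quillen (G : functor E' E) : Prop :=
  exists (F : functor E E') (a : adjunction F G), quillen_adjunction a.

Definition is_homotopy_unit (F : functor E E') (G : functor E' E)
    (a : adjunction F G) (X : E) (Y : E') (u : hom X (G Y)) : Prop :=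
  cofibrant X /\
  exists r : hom (F X) Y, fibrant_replacement r /\ u = adj a r.

Definition is_homotopy_counit (F : functor E E') (G : functor E' E)
    (a : adjunction F G) (X : E) (Y : E') (v : hom (F X) Y) : Prop :=
  fibrant Y /\
  exists q : hom X (G Y), cofibrant_replacement q /\ v = adj_inv a q.

Definition homotopy_coreflection (G : functor E' E) : Prop :=
  exists (F : functor E E') (a : adjunction F G), quillen_adjunction a /\
    forall (X : E) (Y : E') (u : hom X (G Y)), is_homotopy_unit a u -> weq u.

Definition homotopy_reflection (F : functor E E') : Prop :=
  exists (G : functor E' E) (a : adjunction F G), quillen_adjunction a /\
    forall (X : E) (Y : E') (v : hom (F X) Y), is_homotopy_counit a v -> weq v.

Definition homotopy_right_conservative (G : functor E' E) : Prop :=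
  forall (X Y : E') (g : hom X Y), fibrant X -> fibrant Y ->
    (weq g <-> weq (fmap G g)).

Definition homotopy_left_conservative (F : functor E E') : Prop :=
  forall (X Y : E) (f : hom X Y), cofibrant X -> cofibrant Y ->
    (weq f <-> weq (fmap F f)).

End Quillen.

(** * Derived images and coimages *)

(* As usual for functors, a factorisation is given up to natural isomorphism;
   this includes the case of a strict equality.  *)
Record image_factorisation (E' E : model_category) (G : functor E' E) :=
  ImageFactorisation {
    image_obj : model_category;
    image_fst : functor E' image_obj;
    image_snd : functor image_obj E;
    image_fst_coreflection : homotopy_coreflection image_fst;
    image_snd_quillen : right_quillen image_snd;
    image_snd_conservative : homotopy_right_conservative image_snd;
    image_comp : naturally_isomorphic (comp_functor image_snd image_fst) G
  }.

Definition derived_image (E' E : model_category) (G : functor E' E)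
    (fac : image_factorisation G) : category :=
  Ho (image_obj fac).

Record coimage_factorisation (E E' : model_category) (F : functor E E') :=
  CoimageFactorisation {
    coimage_obj : model_category;
    coimage_fst : functor E coimage_obj;
    coimage_snd : functor coimage_obj E';
    coimage_fst_reflection : homotopy_reflection coimage_fst;
    coimage_snd_quillen : left_quillen coimage_snd;
    coimage_snd_conservative : homotopy_left_conservative coimage_snd;
    coimage_comp : naturally_isomorphic (comp_functor coimage_snd coimage_fst) F
  }.

Definition derived_coimage (E E' : model_category) (F : functor E E')
    (fac : coimage_factorisation F) : category :=
  Ho (coimage_obj fac).

(* Main.v *)
Require Import Defs.
From mathcomp Require Import all_boot.
From mathcomp Require Import boolp classical_sets cardinality.

(**
The derived image of [G] is the localization of the full subcategory of fibrant
objects of the source at the class [W] of those maps that [G] sends to weak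
equivalences. This description mentions [G] only, and a localization is unique
up to equivalence, so any two derived images are equivalent.

To see why it holds, factor [G] as a coreflection [G1] from [E'] to [M],
with left adjoint [F1], followed by a conservative [G2]. Right Quillen functors
preserve fibrant objects, so conservativity of [G2] says that [G1] inverts
exactly the maps of [W] ([image_factorisation_weq]). The point is then that
the composite of [G1], restricted to fibrant objects, with the localization
functor of [M] has the universal property of a localization at [W]
([coreflection_localization]).
 - Existence. A functor [K] on fibrant objects that inverts [W] inverts weak
   equivalences, so it extends to all of [E'] ([extend_from_fibrant]). Its
   composite with [F1] inverts weak equivalences between cofibrant objects
   ([ken_brown]), so it extends to [M] ([extend_from_cofibrant]). Restricting
   back along [G1] recovers [K], because the homotopy counits become isomorphisms:
   by a triangle identity [G1] sends them, up to fibrant replacement of their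
   source, to inverses of homotopy units.
 - Uniqueness. The homotopy units link every object of [M], by a zigzag of weak
   equivalences that can be made natural, to an object [G1 Y] with [Y] fibrant.
   Functors on [M] inverting weak equivalences are thus determined by their
   values on such objects.

The extension of functors from cofibrant objects to all objects replaces
[X] by a cofibrant [Q] over [X] and lifts morphisms. The lifts are not unique, but
two lifts of one morphism are left homotopic and hence are identified by every
functor inverting weak equivalences ([fmap_lift_unique]).

The statement on left Quillen functors follows by passing to opposite model
categories: a coimage factorisation becomes an image factorisation, and the
opposite of the localization functor of [M] is a localization of the opposite
of [M] ([localization_op]).
*)

Set Implicit Arguments.
Unset Strict Implicit.
Unset Printing Implicit Defensive.

Local Open Scope cat_scope.

(** * Isomorphisms and natural isomorphisms *)

Section Isomorphisms.
Variable C : category.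

Lemma iso_id (X : C) : is_iso (idc X).
Proof. by exists (idc X); rewrite !compc1. Qed.

Lemma iso_comp (X Y Z : C) (g : hom Y Z) (f : hom X Y) :
  is_iso g -> is_iso f -> is_iso (g ∘ f).
Proof.
move=> [g' [g'g gg']] [f' [f'f ff']]; exists (f' ∘ g'); split.
  by rewrite -compcA (compcA g') g'g comp1c.
by rewrite -compcA (compcA f) ff' comp1c.
Qed.

Lemma iso_cancelr (X Y Z : C) (f : hom X Y) (g h : hom Y Z) :
  is_iso f -> g ∘ f = h ∘ f -> g = h.
Proof.
move=> [f' [_ ff']] e.
by rewrite -[g]compc1 -[h]compc1 -ff' !compcA e.
Qed.

Lemma iso_cancell (X Y Z : C) (f : hom Y Z) (g h : hom X Y) :
  is_iso f -> f ∘ g = f ∘ h -> g = h.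
Proof.
move=> [f' [f'f _]] e.
by rewrite -[g]comp1c -[h]comp1c -f'f -!compcA e.
Qed.

(** The naturality of composites of transformations that are only defined
componentwise, zigzags in particular, is checked by pasting squares. *)
Lemma square_paste (X Y Z X' Y' Z' : C) (f : hom X Y) (g : hom Y Z)
    (f' : hom X' Y') (g' : hom Y' Z') (a : hom X X') (b : hom Y Y') (c : hom Z Z') :
  g' ∘ b = c ∘ g -> f' ∘ a = b ∘ f -> (g' ∘ f') ∘ a = c ∘ (g ∘ f).
Proof. by move=> gE fE; rewrite -compcA fE !compcA gE. Qed.

Definition inv_iso (X Y : C) (f : hom X Y) (f_iso : is_iso f) : hom Y X :=
  sval (cid f_iso).

Section Inverse.
Variables (X Y : C) (f : hom X Y) (f_iso : is_iso f).

Lemma inv_isoK : inv_iso f_iso ∘ f = idc X.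
Proof. by rewrite /inv_iso; case: cid => g []. Qed.

Lemma inv_isoVK : f ∘ inv_iso f_iso = idc Y.
Proof. by rewrite /inv_iso; case: cid => g []. Qed.

Lemma iso_inv : is_iso (inv_iso f_iso).
Proof. by exists f; rewrite inv_isoK inv_isoVK. Qed.

End Inverse.

Lemma inv_iso_natural (X Y X' Y' : C) (f : hom X Y) (f' : hom X' Y')
    (f_iso : is_iso f) (f'_iso : is_iso f') (a : hom X X') (b : hom Y Y') :
  f' ∘ a = b ∘ f -> inv_iso f'_iso ∘ b = a ∘ inv_iso f_iso.
Proof.
move=> e; apply: (iso_cancelr f_iso); rewrite -!compcA inv_isoK -e.
by rewrite compcA inv_isoK comp1c compc1.
Qed.

End Isomorphisms.

Lemma iso_fmap (C D : category) (F : functor C D) (X Y : C) (f : hom X Y) :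
  is_iso f -> is_iso (fmap F f).
Proof. by move=> [g [gf fg]]; exists (fmap F g); rewrite -!fmapM gf fg !fmap1. Qed.

Section NaturalIsomorphisms.
Variables C D : category.
Implicit Types F G H : functor C D.

Lemma natiso_sym F G : naturally_isomorphic F G -> naturally_isomorphic G F.
Proof.
move=> [t [tN t_iso]]; exists (fun X => inv_iso (t_iso X)); split=> [X Y f|X].
  exact: inv_iso_natural.
exact: iso_inv.
Qed.

Lemma natiso_trans F G H :
  naturally_isomorphic F G -> naturally_isomorphic G H -> naturally_isomorphic F H.
Proof.
move=> [t [tN t_iso]] [s [sN s_iso]]; exists (fun X => s X ∘ t X).
split=> [X Y f|X]; last exact: iso_comp.
exact: square_paste (sN _ _ f) (tN _ _ f).
Qed.

Lemma natiso_post (E : category) (K : functor D E) F G :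
  naturally_isomorphic F G ->
  naturally_isomorphic (comp_functor K F) (comp_functor K G).
Proof.
move=> [t [tN t_iso]]; exists (fun X => fmap K (t X)); split=> [X Y f|X].
  by rewrite /= -!fmapM tN.
exact: (iso_fmap K (t_iso X)).
Qed.

Lemma natiso_pre (B : category) (K : functor B C) F G :
  naturally_isomorphic F G ->
  naturally_isomorphic (comp_functor F K) (comp_functor G K).
Proof.
move=> [t [tN t_iso]]; exists (fun X => t (K X)); split=> [X Y f|X].
  exact: tN.
exact: t_iso.
Qed.

End NaturalIsomorphisms.

(** * Localizations *)

Definition inverts (C D : category) (W : morphism_class C) (F : functor C D) : Prop :=
  forall (X Y : C) (f : hom X Y), W X Y f -> is_iso (fmap F f).

Definition preimage_class (C D : category) (F : functor C D)
    (W : morphism_class D) : morphism_class C :=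
  fun X Y f => W (F X) (F Y) (fmap F f).

(** A localization in the sense of bicategories: functors out of [C] inverting
[W] extend along [g] only up to natural isomorphism. This weak form is
enough for uniqueness up to equivalence. In [loc_unique] only the existence of
an isomorphism is recorded, not its compatibility with the given one. *)
Record is_localization (C L : category) (W : morphism_class C)
    (g : functor C L) : Prop := IsLocalization {
  loc_inverts : inverts W g;
  loc_extend : forall (D : category) (F : functor C D), inverts W F ->
    exists F' : functor L D, naturally_isomorphic (comp_functor F' g) F;
  loc_unique : forall (D : category) (A B : functor L D),
    naturally_isomorphic (comp_functor A g) (comp_functor B g) ->
    naturally_isomorphic A B
}.

Lemma localizations_equivalent (C L L' : category) (W : morphism_class C)
    (g : functor C L) (g' : functor C L') :
  is_localization W g -> is_localization W g' -> equivalent_categories L L'.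
Proof.
move=> lg lg'.
have [P Pg] := loc_extend lg (loc_inverts lg').
have [Q Qg'] := loc_extend lg' (loc_inverts lg).
exists P, Q; split.
  apply: (loc_unique lg).
  exact: (natiso_trans (natiso_post Q Pg) Qg').
apply: (loc_unique lg').
exact: (natiso_trans (natiso_post P Qg') Pg).
Qed.

Lemma inverts_comp (C D E : category) (W : morphism_class C) (F : functor C D)
    (K : functor D E) :
  inverts W F -> inverts W (comp_functor K F).
Proof. by move=> FW X Y f Wf; apply: (iso_fmap K (FW _ _ _ Wf)). Qed.

Section HoLocalization.
Variable M : model_category.

Lemma ho_functor_fmapM (X Y Z : M) (g : hom Y Z) (f : hom X Y) :
  word_class (word_map (g ∘ f))
    = ho_comp (word_class (word_map g)) (word_class (word_map f)).
Proof. by rewrite ho_compE; apply/word_classP; apply: word_eq_mapM. Qed.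

Definition ho_functor : functor M (Ho M) :=
  @Functor M (Ho M) (fun X => X) (fun X Y f => word_class (word_map f))
    (fun X => (word_classP _ _).2 (word_eq_map1 X)) ho_functor_fmapM.

Section Evaluation.
Variables (D : category) (F : functor M D) (FW : inverts (@weq M) F).

(** Words are evaluated in any category where the weak equivalences become
invertible. *)
Fixpoint word_eval (X Y : M) (p : word X Y) : hom (F X) (F Y) :=
  match p in word X Y return hom (F X) (F Y) with
  | word_id X => idc (F X)
  | word_map _ _ f => fmap F f
  | word_inv _ _ w weq_w => inv_iso (FW weq_w)
  | word_comp _ _ _ q p => word_eval q ∘ word_eval p
  end.

Lemma word_eval_eq (X Y : M) (p q : word X Y) :
  word_eq p q -> word_eval p = word_eval q.
Proof.
elim=> {X Y p q} //=.
- by move=> X Y p q r _ -> _ ->.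
- by move=> X Y Z q q' p p' _ -> _ ->.
- by move=> *; rewrite compc1.
- by move=> *; rewrite comp1c.
- by move=> *; rewrite compcA.
- by move=> *; rewrite fmap1.
- by move=> *; rewrite fmapM.
- by move=> *; rewrite inv_isoVK.
- by move=> *; rewrite inv_isoK.
Qed.

Lemma ho_extend_fmap1 (X : M) : word_eval (word_repr (ho_id X)) = idc (F X).
Proof. exact: (word_eval_eq (word_classK _)). Qed.

Lemma ho_extend_fmapM (X Y Z : M) (b : ho_hom Y Z) (a : ho_hom X Y) :
  word_eval (word_repr (ho_comp b a))
    = word_eval (word_repr b) ∘ word_eval (word_repr a).
Proof. exact: (word_eval_eq (word_classK _)). Qed.

Definition ho_extend : functor (Ho M) D :=
  @Functor (Ho M) D (fun X => F X) (fun X Y a => word_eval (word_repr a))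
    ho_extend_fmap1 ho_extend_fmapM.

End Evaluation.

Lemma ho_functor_inverts : inverts (@weq M) ho_functor.
Proof.
move=> X Y f wf; exists (word_class (word_inv wf)); split.
  by rewrite /= ho_compE; apply/word_classP; apply: word_eq_Vmap.
by rewrite /= ho_compE; apply/word_classP; apply: word_eq_mapV.
Qed.

(** Every morphism of [Ho M] is a word in morphisms of [M] and inverses of weak
equivalences. A family natural for the former is natural for the latter too, hence
for all words. *)
Lemma ho_localization : is_localization (@weq M) ho_functor.
Proof.
split.
- exact: ho_functor_inverts.
- move=> D F FW; exists (ho_extend FW), (fun X => idc (F X)).
  split=> [X Y f|X]; last exact: iso_id.
  by rewrite comp1c compc1; apply: (word_eval_eq FW (word_classK _)).
- move=> D A B [t [tN t_iso]]; exists t; split=> // X Y a.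
  rewrite -(word_reprK a); elim: (word_repr a) => {X Y a}.
  + by move=> X; rewrite (fmap1 A X : fmap A (word_class _) = _)
      (fmap1 B X : fmap B (word_class _) = _) compc1 comp1c.
  + by move=> X Y f; apply: tN.
  + move=> X Y w ww.
    have wi : is_iso (fmap A (fmap ho_functor w)).
      by apply: iso_fmap; apply: ho_functor_inverts.
    apply: (iso_cancelr wi).
    have Vw : (word_class (word_inv ww) : @hom (Ho M) Y X) ∘ fmap ho_functor w
        = idc (X : Ho M).
      by rewrite /= ho_compE; apply/word_classP; apply: word_eq_Vmap.
    have tw := tN _ _ w; rewrite /= in tw.
    rewrite -!compcA -fmapM Vw fmap1 /= tw compcA -fmapM.
    have -> : (word_class (word_inv ww) : @hom (Ho M) Y X)
       ∘ (word_class (word_map w) : @hom (Ho M) X Y) = idc (X : Ho M) by [].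
    by rewrite fmap1 compc1 comp1c.
  + move=> X Y Z q IHq p IHp.
    have -> : word_class (word_comp q p)
        = (word_class q : @hom (Ho M) Y Z) ∘ (word_class p : @hom (Ho M) X Y).
      by rewrite /= ho_compE.
    by rewrite !fmapM compcA IHq -!compcA IHp.
Qed.

End HoLocalization.

(** * Duality *)

Definition op (C : category) : category :=
  @Category C (fun X Y => @hom C Y X) (fun X => idc X)
    (fun X Y Z g f => f ∘ g) (fun X Y f => comp1c f) (fun X Y f => compc1 f)
    (fun X Y Z T h g f => esym (compcA f g h)).

Definition op_functor (C D : category) (F : functor C D) : functor (op C) (op D) :=
  @Functor (op C) (op D) (fun X => F X) (fun X Y f => fmap F f)
    (fun X => fmap1 F X) (fun X Y Z g f => fmapM F f g).

(** The double opposite of a category is not convertible to the category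
itself, so each way of moving a functor across [op] is a separate definition. *)
Definition unop_functor (C D : category) (F : functor (op C) (op D)) : functor C D :=
  @Functor C D (fun X => F X) (fun X Y f => @fmap (op C) (op D) F Y X f)
    (fun X => fmap1 F X) (fun X Y Z g f => @fmapM (op C) (op D) F Z Y X f g).

Definition op_dom_functor (C D : category) (F : functor C (op D)) :
    functor (op C) D :=
  @Functor (op C) D (fun X => F X) (fun X Y f => @fmap C (op D) F Y X f)
    (fun X => fmap1 F X) (fun X Y Z g f => @fmapM C (op D) F Z Y X f g).

Definition op_cod_functor (C D : category) (F : functor (op C) D) :
    functor C (op D) :=
  @Functor C (op D) (fun X => F X) (fun X Y f => @fmap (op C) D F Y X f)
    (fun X => fmap1 F X) (fun X Y Z g f => @fmapM (op C) D F Z Y X f g).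

Lemma op_iso (C : category) (X Y : C) (f : hom X Y) :
  is_iso f -> @is_iso (op C) Y X f.
Proof. by move=> [g [gf fg]]; exists g. Qed.

Lemma unop_iso (C : category) (X Y : C) (f : hom X Y) :
  @is_iso (op C) Y X f -> is_iso f.
Proof. by move=> [g [gf fg]]; exists g. Qed.

Definition op_class (C : category) (W : morphism_class C) : morphism_class (op C) :=
  fun X Y f => W Y X f.

Lemma natiso_op (C D : category) (F G : functor C D) :
  naturally_isomorphic F G -> naturally_isomorphic (op_functor F) (op_functor G).
Proof.
move=> /natiso_sym[t [tN t_iso]]; exists t; split=> [X Y f|X].
  exact: (esym (tN _ _ f)).
exact: (op_iso (t_iso X)).
Qed.

Lemma natiso_unop (C D : category) (F G : functor (op C) (op D)) :
  naturally_isomorphic F G ->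
  naturally_isomorphic (unop_functor G) (unop_functor F).
Proof.
move=> [t [tN t_iso]]; exists t; split=> [X Y f|X].
  exact: (esym (tN _ _ f)).
exact: (unop_iso (t_iso X)).
Qed.

(** Passing to opposites reverses natural transformations, but equivalences
involve only natural isomorphisms. *)
Lemma equivalent_unop (C D : category) :
  equivalent_categories (op C) (op D) -> equivalent_categories C D.
Proof.
move=> [F [G [GF FG]]]; exists (unop_functor F), (unop_functor G); split.
  exact: (natiso_sym (natiso_unop GF)).
exact: (natiso_sym (natiso_unop FG)).
Qed.

Lemma natiso_op_dom (C D : category) (F G : functor C (op D)) :
  naturally_isomorphic F G ->
  naturally_isomorphic (op_dom_functor G) (op_dom_functor F).
Proof.
move=> [t [tN t_iso]]; exists t; split=> [X Y f|X].
  exact: (esym (tN _ _ f)).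
exact: (unop_iso (t_iso X)).
Qed.

Lemma natiso_op_cod (C D : category) (F G : functor (op C) D) :
  naturally_isomorphic F G ->
  naturally_isomorphic (op_cod_functor G) (op_cod_functor F).
Proof.
move=> [t [tN t_iso]]; exists t; split=> [X Y f|X].
  exact: (esym (tN _ _ f)).
exact: (op_iso (t_iso X)).
Qed.

Lemma localization_op (C L : category) (W : morphism_class C) (g : functor C L) :
  is_localization W g -> is_localization (op_class W) (op_functor g).
Proof.
move=> lg; split.
- by move=> X Y f Wf; apply: op_iso; apply: (loc_inverts lg).
- move=> D F FW.
  have [|F' F'g] := @loc_extend _ _ _ _ lg _ (op_cod_functor F).
    by move=> X Y f Wf; apply: op_iso; apply: FW.
  exists (op_dom_functor F').
  exact: (natiso_sym (natiso_op_dom F'g)).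
- move=> D A B AB.
  have AB' := loc_unique lg (natiso_op_cod AB
    : naturally_isomorphic (comp_functor (op_cod_functor B) g)
                           (comp_functor (op_cod_functor A) g)).
  exact: (natiso_op_dom AB').
Qed.

Lemma adj_invN (C D : category) (F : functor C D) (G : functor D C)
    (a : adjunction F G) (X X' : C) (Y Y' : D)
    (h : hom X' X) (u : hom X (G Y)) (k : hom Y Y') :
  adj_inv a (fmap G k ∘ u ∘ h) = k ∘ adj_inv a u ∘ fmap F h.
Proof. by rewrite -{1}(adj_invK a u) -adj_natural adjK. Qed.

Definition op_adjunction (C D : category) (F : functor C D) (G : functor D C)
    (a : adjunction F G) : adjunction (op_functor G) (op_functor F).
Proof.
refine (@Adjunction (op D) (op C) (op_functor G) (op_functor F)
  (fun X Y f => adj_inv a f) (fun X Y f => adj a f)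
  (fun X Y f => adj_invK a f) (fun X Y f => adjK a f) _).
by move=> X X' Y Y' h f k /=; rewrite compcA adj_invN compcA.
Defined.

Lemma finite_category_op (J : category) : finite_category J -> finite_category (op J).
Proof. by move=> [fJ fhom]; split=> // i j; apply: fhom. Qed.

Lemma finite_limits_op (C : category) :
  has_finite_colimits C -> has_finite_limits (op C).
Proof.
move=> colimC J D /finite_category_op fJ.
have [c [q [qD qU]]] := colimC _ (op_dom_functor D) fJ.
exists c, q; split=> [i j u|d p pD]; first exact: qD.
have [|h [hp hU]] := qU d p; first by move=> i j u; apply: pD.
by exists h; split.
Qed.

Lemma finite_colimits_op (C : category) :
  has_finite_limits C -> has_finite_colimits (op C).
Proof.
move=> limC J D /finite_category_op fJ.
have [c [q [qD qU]]] := limC _ (op_dom_functor D) fJ.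
exists c, q; split=> [i j u|d p pD]; first exact: qD.
have [|h [hp hU]] := qU d p; first by move=> i j u; apply: pD.
by exists h; split.
Qed.

Lemma two_out_of_three_op (C : category) (W : morphism_class C) :
  two_out_of_three W -> two_out_of_three (op_class W).
Proof.
move=> W23 X Y Z f g; have [c l r] := W23 _ _ _ g f.
by split=> [Wf Wg||]; [apply: c | apply: r | apply: l].
Qed.

Lemma retract_closed_op (C : category) (W : morphism_class C) :
  retract_closed W -> retract_closed (op_class W).
Proof.
move=> Wr X Y X' Y' f g [i [r [j [s [ri sj gi fr]]]]].
by apply: (Wr Y X Y' X' f g); exists s, j, r, i; split.
Qed.

Lemma has_lifting_op (C : category) (A B X Y : C) (i : hom A B) (p : hom X Y) :
  has_lifting i p -> @has_lifting (op C) Y X B A p i.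
Proof.
move=> ip u v e; have [h [hi ph]] := ip v u (esym e).
by exists h.
Qed.

Definition op_model (M : model_category) : model_category.
Proof.
refine (@ModelCategory (op M) (op_class (@weq M)) (op_class (@fib M))
  (op_class (@cof M)) (finite_limits_op (@model_colimits M))
  (finite_colimits_op (@model_limits M))
  (two_out_of_three_op (@weq_two_out_of_three M))
  (retract_closed_op (@weq_retract M))
  (retract_closed_op (@fib_retract M)) (retract_closed_op (@cof_retract M))
  _ _ _ _).
- move=> A B X Y i p fi wi cp; apply: has_lifting_op.
  exact: lift_acyclic_fib cp fi wi.
- move=> A B X Y i p fi cp wp; apply: has_lifting_op.
  exact: lift_acyclic_cof cp wp fi.
- move=> X Y f; have [Z [i [p [ci fp wp pi]]]] := @factor_acyclic_fib M Y X f.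
  by exists Z, p, i.
- move=> X Y f; have [Z [i [p [ci wi fp pi]]]] := @factor_acyclic_cof M Y X f.
  by exists Z, p, i.
Defined.

Lemma quillen_adjunction_op (E E' : model_category) (F : functor E E')
    (G : functor E' E) (a : adjunction F G) :
  quillen_adjunction a ->
  @quillen_adjunction (op_model E') (op_model E) (op_functor G) (op_functor F)
    (op_adjunction a).
Proof. by move=> [Fc Gf]; split=> X Y f; [apply: Gf | apply: Fc]. Qed.

Lemma fibrant_op (M : model_category) (X : M) :
  @fibrant (op_model M) X <-> cofibrant X.
Proof. by split=> -[T [f Tf]]; exists T, f. Qed.

Lemma cofibrant_op (M : model_category) (X : M) :
  @cofibrant (op_model M) X <-> fibrant X.
Proof. by split=> -[T [f Tf]]; exists T, f. Qed.

Lemma coreflection_op (E E' : model_category) (F : functor E E') :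
  homotopy_reflection F ->
  @homotopy_coreflection (op_model E') (op_model E) (op_functor F).
Proof.
move=> [G [a [aQ counit]]].
exists (op_functor G), (op_adjunction a); split; first exact: quillen_adjunction_op.
move=> X Y u [cX [r [[fY cr wr] ->]]].
apply: counit; split; first exact/cofibrant_op.
by exists r; split=> //; split=> //; apply/fibrant_op.
Qed.

(** * Cofibrations and cofibrant objects *)

(** Initial objects and binary coproducts are extracted from finite colimits as
the colimits of the discrete diagrams on [void] and [bool]. *)
Definition discrete_cat (T : finType) : category.
Proof.
refine (@Category T (fun i j => i = j) (fun i => erefl)
  (fun i j k jk ij => etrans ij jk) _ _ _) => *; exact: Prop_irrelevance.
Defined.

Lemma discrete_cat_finite (T : finType) : finite_category (discrete_cat T).
Proof.
split=> [|i j]; first exact: finite_finset.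
have [e|ne] := pselect (i = j).
  apply: (@sub_finite_set _ _ [set e : i = j :> T]%classic); last exact: finite_set1.
  by move=> f _; apply: Prop_irrelevance.
apply: (@sub_finite_set _ _ set0); last exact: finite_set0.
by move=> f.
Qed.

Definition discrete_functor (T : finType) (C : category) (c : T -> C) :
  functor (discrete_cat T) C.
Proof.
refine (@Functor (discrete_cat T) C c
  (fun i j (e : i = j) => ecast k (hom (c i) (c k)) e (idc (c i))) _ _) => //.
by move=> i j k jk ij; case: k / jk; case: j / ij; rewrite /= compc1.
Defined.

Lemma initial_exists (M : model_category) : exists I : M, is_initial I.
Proof.
pose c (v : void) : M := match v with end.
have [I [q [_ qU]]] :=
  model_colimits (discrete_functor c) (discrete_cat_finite _).
exists I => X.
have [|h [_ hU]] := qU X (fun v : void => match v with end); first by case.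
by exists h; split=> // h' _; apply: hU; case.
Qed.

Lemma coproduct_exists (M : model_category) (A B : M) :
  exists (P : M) (a : hom A P) (b : hom B P),
    (forall (T : M) (f : hom A T) (g : hom B T),
       exists h, h ∘ a = f /\ h ∘ b = g) /\
    (forall (T : M) (h k : hom P T), h ∘ a = k ∘ a -> h ∘ b = k ∘ b -> h = k).
Proof.
pose c (x : bool) : M := if x then A else B.
have [P [q [qC qU]]] :=
  model_colimits (discrete_functor c) (discrete_cat_finite _).
have cone (T : M) (p : forall x : bool, hom (c x) T) :
    is_cocone (D := discrete_functor c) p.
  by move=> i j ij; case: j / ij; rewrite /= compc1.
exists P, (q true), (q false); split=> [T f g|T h k ha hb].
  have [h [hq _]] := qU T _
    (@cone T (fun x : bool => if x return hom (c x) T then f else g)).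
  by exists h; rewrite (hq true) (hq false).
have [l [_ lU]] := qU T _ (@cone T (fun x => h ∘ q x)).
by rewrite -(lU h) // -(lU k) // => -[].
Qed.

Section Cofibrations.
Variable M : model_category.

Lemma weq_comp (X Y Z : M) (g : hom Y Z) (f : hom X Y) :
  weq g -> weq f -> weq (g ∘ f).
Proof. by move=> wg wf; have [+ _ _] := weq_two_out_of_three f g; apply. Qed.

Lemma weq_cancelr (X Y Z : M) (g : hom Y Z) (f : hom X Y) :
  weq f -> weq (g ∘ f) -> weq g.
Proof. by move=> wf wgf; have [_ + _] := weq_two_out_of_three f g; apply. Qed.

Lemma weq_cancell (X Y Z : M) (g : hom Y Z) (f : hom X Y) :
  weq g -> weq (g ∘ f) -> weq f.
Proof. by move=> wg wgf; have [_ _ +] := weq_two_out_of_three f g; apply. Qed.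

(** Weak equivalences are not assumed to contain identities. However, an identity
is a retract of the first factor in any factorisation of itself. *)
Lemma weq_id (X : M) : weq (idc X).
Proof.
have [Z [i [p [_ wi _ pi]]]] := factor_acyclic_cof (idc X).
apply: (weq_retract (g := i)) => //.
by exists (idc X), (idc X), i, p; rewrite !compc1 pi.
Qed.

Lemma weq_iso (X Y : M) (f : hom X Y) : is_iso f -> weq f.
Proof.
move=> [g [gf fg]]; apply: (weq_retract (g := idc Y)); last exact: weq_id.
by exists f, g, (idc Y), (idc Y); rewrite !compc1 comp1c.
Qed.

(** The retract argument: [i] is a retract of the cofibration in a factorisation
of [i] through an acyclic fibration. *)
Lemma cof_of_lifting (A B : M) (i : hom A B) :
  (forall (X Y : M) (p : hom X Y), fib p -> weq p -> has_lifting i p) -> cof i.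
Proof.
move=> iL; have [Z [j [p [cj fp wp pj]]]] := factor_acyclic_fib i.
have [|h [hi ph]] := iL _ _ p fp wp j (idc B); first by rewrite comp1c.
apply: (cof_retract (g := j)) => //.
by exists (idc A), (idc A), h, p; rewrite !compc1.
Qed.

(** The retract argument for the other factorisation. *)
Lemma acyclic_cof_of_lifting (A B : M) (i : hom A B) :
  (forall (X Y : M) (p : hom X Y), fib p -> has_lifting i p) -> weq i.
Proof.
move=> iL; have [Z [j [p [cj wj fp pj]]]] := factor_acyclic_cof i.
have [|h [hi ph]] := iL _ _ p fp j (idc B); first by rewrite comp1c.
apply: (weq_retract (g := j)) => //.
by exists (idc A), (idc A), h, p; rewrite !compc1.
Qed.

Lemma cof_comp (A B C : M) (j : hom B C) (i : hom A B) :
  cof j -> cof i -> cof (j ∘ i).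
Proof.
move=> cj ci; apply: cof_of_lifting => X Y p fp wp u v e.
have [|h [hi ph]] := lift_acyclic_fib ci fp wp (u := u) (v := v ∘ j).
  by rewrite e compcA.
have [k [kj pk]] := lift_acyclic_fib cj fp wp ph.
by exists k; rewrite compcA kj.
Qed.

Lemma initial_eq (I X : M) (f g : hom I X) : is_initial I -> f = g.
Proof. by move=> /(_ X)[h [_ hU]]; rewrite -(hU f) // -(hU g). Qed.

Lemma cofibrant_lift (A X Y : M) (p : hom X Y) (f : hom A Y) :
  cofibrant A -> fib p -> weq p -> exists g, p ∘ g = f.
Proof.
move=> [I [i [I0 ci]]] fp wp; have [u _] := I0 X.
have [|h [_ ph]] := lift_acyclic_fib ci fp wp (u := u) (v := f).
  exact: initial_eq.
by exists h.
Qed.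

Lemma cofibrant_cod (A B : M) (i : hom A B) : cofibrant A -> cof i -> cofibrant B.
Proof.
by move=> [I [j [I0 cj]]] ci; exists I, (i ∘ j); split=> //; apply: cof_comp.
Qed.

(** To lift along the injection of [A], a map must also be chosen on [B]. It
exists because [B] is cofibrant. *)
Lemma coproduct_cof (A B : M) : cofibrant A -> cofibrant B ->
  exists (P : M) (a : hom A P) (b : hom B P), [/\ cof a, cof b,
    forall (T : M) (f : hom A T) (g : hom B T),
      exists h, h ∘ a = f /\ h ∘ b = g
    & forall (T : M) (h k : hom P T), h ∘ a = k ∘ a -> h ∘ b = k ∘ b -> h = k].
Proof.
move=> cA cB; have [P [a [b [ex un]]]] := coproduct_exists A B.
exists P, a, b; split=> //; apply: cof_of_lifting => X Y p fp wp u v e.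
  have [w pw] := cofibrant_lift (v ∘ b) cB fp wp.
  have [h [ha hb]] := ex _ u w.
  by exists h; split=> //; apply: un; rewrite -compcA ?ha ?hb.
have [w pw] := cofibrant_lift (v ∘ a) cA fp wp.
have [h [ha hb]] := ex _ w u.
by exists h; split=> //; apply: un; rewrite -compcA ?ha ?hb.
Qed.

Lemma cofibrant_replacement_exists (X : M) :
  exists (Q : M) (q : hom Q X), cofibrant_replacement q.
Proof.
have [I I0] := initial_exists M; have [u _] := I0 X.
have [Q [i [q [ci fq wq _]]]] := factor_acyclic_fib u.
by exists Q, q; split=> //; exists I, i.
Qed.

Definition repl (X : M) : M := sval (cid (cofibrant_replacement_exists X)).

Definition repl_map (X : M) : hom (repl X) X :=
  sval (cid (svalP (cid (cofibrant_replacement_exists X)))).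

Lemma repl_mapP (X : M) : cofibrant_replacement (repl_map X).
Proof. exact: svalP (cid (svalP (cid (cofibrant_replacement_exists X)))). Qed.

Lemma repl_cofibrant (X : M) : cofibrant (repl X).
Proof. by case: (repl_mapP X). Qed.

Lemma repl_fib (X : M) : fib (repl_map X).
Proof. by case: (repl_mapP X). Qed.

Lemma repl_weq (X : M) : weq (repl_map X).
Proof. by case: (repl_mapP X). Qed.

End Cofibrations.

Definition fib_repl (M : model_category) (X : M) : M := @repl (op_model M) X.

Definition fib_repl_map (M : model_category) (X : M) : hom X (fib_repl X) :=
  @repl_map (op_model M) X.

Lemma fib_repl_mapP (M : model_category) (X : M) :
  fibrant_replacement (fib_repl_map X).
Proof.
have [fR cr wr] := @repl_mapP (op_model M) X.
by split=> //; apply/cofibrant_op.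
Qed.

Lemma fibrant_extend (M : model_category) (X Y B : M) (i : hom X Y) (f : hom X B) :
  fibrant B -> cof i -> weq i -> exists g, g ∘ i = f.
Proof. by move/cofibrant_op; apply: (@cofibrant_lift (op_model M) B Y X i f). Qed.

(** * Quillen functors *)

Section LeftQuillen.
Variables (E E' : model_category) (F : functor E E') (G : functor E' E).
Variables (a : adjunction F G) (aQ : quillen_adjunction a).

Lemma adj_post (X : E) (Y Y' : E') (k : hom Y Y') (f : hom (F X) Y) :
  adj a (k ∘ f) = fmap G k ∘ adj a f.
Proof. by rewrite -[k ∘ f]compc1 -(fmap1 F) adj_natural compc1. Qed.

Lemma adj_pre (X X' : E) (Y : E') (f : hom (F X) Y) (h : hom X' X) :
  adj a (f ∘ fmap F h) = adj a f ∘ h.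
Proof. by rewrite -[f]comp1c adj_natural fmap1 !comp1c. Qed.

Lemma adj_inj (X : E) (Y : E') : injective (@adj _ _ _ _ a X Y).
Proof. exact: can_inj (@adjK _ _ _ _ a X Y). Qed.

(** Lifting problems of [fmap F i] against fibrations transpose to lifting
problems of [i] against their images by [G]. *)
Lemma left_quillen_acyclic_cof (X Y : E) (i : hom X Y) :
  cof i -> weq i -> weq (fmap F i).
Proof.
move=> ci wi; apply: acyclic_cof_of_lifting => S T p fp u v e.
have [|h [hi ph]] :=
  lift_acyclic_cof ci wi (aQ.2 _ _ p fp) (u := adj a u) (v := adj a v).
  by rewrite -adj_post -adj_pre e.
exists (adj_inv a h); split; apply: adj_inj.
  by rewrite adj_pre adj_invK.
by rewrite adj_post adj_invK.
Qed.

(** Ken Brown's lemma. Factoring the map from the coproduct of [X] and [Y] to [Y]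
with components [f] and the identity writes [f] as an acyclic cofibration
followed by a map [s] that has an acyclic cofibration as a section, and [F]
preserves acyclic cofibrations. *)
Lemma ken_brown (X Y : E) (f : hom X Y) :
  cofibrant X -> cofibrant Y -> weq f -> weq (fmap F f).
Proof.
move=> cX cY wf.
have [P [x [y [cx cy ex _]]]] := coproduct_cof cX cY.
have [h [hx hy]] := ex _ f (idc Y).
have [Z [j [s [cj fs ws sj]]]] := factor_acyclic_fib h.
have sx : s ∘ (j ∘ x) = f by rewrite compcA sj.
have sy : s ∘ (j ∘ y) = idc Y by rewrite compcA sj.
have wx : weq (j ∘ x) by apply: (weq_cancell ws); rewrite sx.
have wy : weq (j ∘ y) by apply: (weq_cancell ws); rewrite sy; apply: weq_id.
have wFs : weq (fmap F s).
  apply: (weq_cancelr (f := fmap F (j ∘ y))).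
    by apply: left_quillen_acyclic_cof => //; apply: cof_comp.
  by rewrite -fmapM sy fmap1; apply: weq_id.
rewrite -sx fmapM; apply: weq_comp => //.
by apply: left_quillen_acyclic_cof => //; apply: cof_comp.
Qed.

(** A right adjoint preserves terminal objects. *)
Lemma right_quillen_fibrant (Y : E') : fibrant Y -> fibrant (G Y).
Proof.
move=> [T [f [T1 ff]]]; exists (G T), (fmap G f); split; last exact: aQ.2.
move=> X; have [h [_ hU]] := T1 (F X); exists (adj a h); split=> // g _.
by rewrite (hU (adj_inv a g)) // adj_invK.
Qed.

End LeftQuillen.

Lemma ken_brown_right (E E' : model_category) (F : functor E E') (G : functor E' E)
    (a : adjunction F G) (X Y : E') (g : hom X Y) :
  quillen_adjunction a -> fibrant X -> fibrant Y -> weq g -> weq (fmap G g).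
Proof.
move=> /quillen_adjunction_op aQ /cofibrant_op fX /cofibrant_op fY wg.
exact: (ken_brown aQ fY fX wg).
Qed.

(** * Extending functors from cofibrant objects *)

Definition full_sub (C : category) (P : C -> Prop) : category :=
  @Category {X : C | P X} (fun X Y => hom (sval X) (sval Y))
    (fun X => idc (sval X)) (fun X Y Z g f => g ∘ f)
    (fun X Y f => compc1 f) (fun X Y f => comp1c f)
    (fun X Y Z T h g f => compcA h g f).

Definition incl (C : category) (P : C -> Prop) : functor (full_sub P) C :=
  @Functor (full_sub P) C (fun X => sval X) (fun X Y f => f)
    (fun=> erefl) (fun _ _ _ _ _ => erefl).

Section CofibrantExtension.
Variables (M : model_category) (D : category).
Variable H : functor (full_sub (@cofibrant M)) D.
Hypothesis HW : inverts (preimage_class (incl (@cofibrant M)) (@weq M)) H.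

(** Two lifts [f] and [g] of one morphism through an acyclic fibration [q] are
left homotopic: both factor through a cylinder [Z] of [A] as [h' ∘ x'] and [h' ∘ y'].
The projection [s'] of the cylinder is a weak equivalence between cofibrant
objects, so [H] inverts it and identifies its two sections [x'] and [y']. *)
Lemma fmap_lift_unique (A B : full_sub (@cofibrant M)) (Y : M)
    (q : hom (sval B) Y) (f g : hom (sval A) (sval B)) :
  fib q -> weq q -> q ∘ f = q ∘ g ->
  @fmap _ _ H A B f = @fmap _ _ H A B g.
Proof.
move=> fq wq e; have cA := svalP A.
have [P [x [y [cx cy ex un]]]] := coproduct_cof cA cA.
have [d [dx dy]] := ex _ (idc (sval A)) (idc (sval A)).
have [Z [j [s [cj fs ws sj]]]] := factor_acyclic_fib d.
have cZ : cofibrant Z by apply: cofibrant_cod cj; apply: cofibrant_cod cx.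
have [fg [fgx fgy]] := ex _ f g.
have [|h [hj qh]] := lift_acyclic_fib cj fq wq (u := fg) (v := (q ∘ f) ∘ s).
  by rewrite -(compcA _ s) sj; apply: un;
    rewrite -!compcA ?fgx ?fgy ?dx ?dy compc1.
(* the cylinder and its structure maps, as data in the subcategory *)
pose Z' : full_sub (@cofibrant M) := exist _ Z cZ.
pose s' : hom Z' A := s; pose h' : hom Z' B := h.
pose x' : hom A Z' := j ∘ x; pose y' : hom A Z' := j ∘ y.
have Hxy : fmap H x' = fmap H y'.
  have s_iso : is_iso (fmap H s') by apply: HW.
  apply: (iso_cancell s_iso); rewrite -!fmapM; congr (fmap H _).
  by rewrite /= !compcA sj dx dy.
have <- : h' ∘ x' = f by rewrite /= compcA hj.
have <- : h' ∘ y' = g by rewrite /= compcA hj.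
by rewrite !fmapM Hxy.
Qed.

Definition repl_sub (X : M) : full_sub (@cofibrant M) :=
  exist _ (repl X) (repl_cofibrant X).

Definition repl_lift_exists (X Y : M) (f : hom X Y) :
  exists g : hom (repl X) (repl Y), repl_map Y ∘ g = f ∘ repl_map X :=
  cofibrant_lift (f ∘ repl_map X) (repl_cofibrant X) (repl_fib Y) (repl_weq Y).

Definition repl_lift (X Y : M) (f : hom X Y) : hom (repl_sub X) (repl_sub Y) :=
  sval (cid (repl_lift_exists f)).

Lemma repl_liftE (X Y : M) (f : hom X Y) :
  repl_map Y ∘ (repl_lift f : hom (repl X) (repl Y)) = f ∘ repl_map X.
Proof. exact: svalP (cid (repl_lift_exists f)). Qed.

Lemma repl_fmap1 (X : M) : fmap H (repl_lift (idc X)) = idc (H (repl_sub X)).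
Proof.
rewrite -fmap1.
apply: (@fmap_lift_unique (repl_sub X) (repl_sub X) _ _ _ _ (repl_fib X) (repl_weq X)).
by rewrite repl_liftE comp1c compc1.
Qed.

Lemma repl_fmapM (X Y Z : M) (g : hom Y Z) (f : hom X Y) :
  fmap H (repl_lift (g ∘ f)) = fmap H (repl_lift g) ∘ fmap H (repl_lift f).
Proof.
rewrite -fmapM.
apply: (@fmap_lift_unique (repl_sub X) (repl_sub Z) _ _ _ _ (repl_fib Z) (repl_weq Z)).
by rewrite repl_liftE compcA repl_liftE -!compcA repl_liftE.
Qed.

Definition cofibrant_extension : functor M D :=
  @Functor M D (fun X => H (repl_sub X)) (fun X Y f => fmap H (repl_lift f))
    repl_fmap1 repl_fmapM.

Lemma cofibrant_extension_inverts : inverts (@weq M) cofibrant_extension.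
Proof.
move=> X Y f wf; apply: HW.
apply: (weq_cancell (repl_weq Y)); rewrite repl_liftE.
exact: weq_comp wf (repl_weq X).
Qed.

Lemma cofibrant_extensionE :
  naturally_isomorphic (comp_functor cofibrant_extension (incl (@cofibrant M))) H.
Proof.
exists (fun X => @fmap _ _ H (repl_sub (sval X)) X (repl_map (sval X))).
split=> [X Y f|X]; last by apply: HW; apply: repl_weq.
rewrite /= -!fmapM; congr (fmap H _).
exact: repl_liftE.
Qed.

End CofibrantExtension.

Lemma extend_from_cofibrant (M : model_category) (D : category)
    (H : functor (full_sub (@cofibrant M)) D) :
  inverts (preimage_class (incl (@cofibrant M)) (@weq M)) H ->
  exists2 K : functor M D, inverts (@weq M) K
    & naturally_isomorphic (comp_functor K (incl (@cofibrant M))) H.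
Proof.
move=> HW; exists (cofibrant_extension HW).
  exact: cofibrant_extension_inverts.
exact: cofibrant_extensionE.
Qed.

(** The fibrant objects of [M] are the cofibrant objects of the opposite of [M].
The two subcategories are opposite to each other by conversion, so [H] can be read
as a functor on the latter. *)
Lemma extend_from_fibrant (M : model_category) (D : category)
    (H : functor (full_sub (@fibrant M)) D) :
  inverts (preimage_class (incl (@fibrant M)) (@weq M)) H ->
  exists2 K : functor M D, inverts (@weq M) K
    & naturally_isomorphic (comp_functor K (incl (@fibrant M))) H.
Proof.
move=> HW.
pose Hop : functor (full_sub (@cofibrant (op_model M))) (op D) :=
  @Functor (full_sub (@cofibrant (op_model M))) (op D) (fun X => H X)
    (fun X Y f => @fmap _ _ H Y X f)
    (fun X => fmap1 H X) (fun X Y Z g f => @fmapM _ _ H Z Y X f g).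
have [|K KW [t [tN t_iso]]] := @extend_from_cofibrant (op_model M) (op D) Hop.
  by move=> X Y f wf; apply: op_iso; apply: HW.
exists (unop_functor (K : functor (op M) (op D))).
  by move=> X Y f wf; apply: unop_iso; apply: KW.
apply: natiso_sym; exists t; split=> [X Y f|X]; last exact: (unop_iso (t_iso X)).
exact: (esym (tN _ _ f)).
Qed.

(** * Coreflections as localizations *)

Section Coreflection.
Variables (E M : model_category) (F : functor M E) (G : functor E M).
Variables (a : adjunction F G) (aQ : quillen_adjunction a).
Hypothesis unit_weq : forall (X : M) (Y : E) (u : hom X (G Y)),
  is_homotopy_unit a u -> weq u.

Let Ef := full_sub (@fibrant E).
Let Gf : functor Ef M := comp_functor G (incl (@fibrant E)).

(** Choose a cofibrant replacement [Q] of [X] and a fibrant replacement [Y] of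
[F Q]. The zigzag [X <- Q -> G Y], whose second arrow is a homotopy unit,
consists of weak equivalences. The component at [X] is obtained by going along
its image by [A], then [t], and back along its image by [B]. *)
Lemma coreflection_unique (D : category) (A B : functor M D) :
  inverts (@weq M) A -> inverts (@weq M) B ->
  naturally_isomorphic (comp_functor A Gf) (comp_functor B Gf) ->
  naturally_isomorphic A B.
Proof.
move=> AW BW [t [tN t_iso]].
pose R X := fib_repl (F (repl X)).
have RP X : fibrant_replacement (fib_repl_map (F (repl X))) := fib_repl_mapP _.
pose R' X : Ef := exist _ (R X) (let: And3 fR _ _ := RP X in fR).
pose u X : hom (repl X) (Gf (R' X)) := adj a (fib_repl_map (F (repl X))).
have wu X : weq (u X).
  apply: unit_weq; split; first exact: repl_cofibrant.
  by exists (fib_repl_map (F (repl X))).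
have Aq X := AW _ _ _ (repl_weq X).
have Bq X := BW _ _ _ (repl_weq X).
have Au X := AW _ _ _ (wu X).
have Bu X := BW _ _ _ (wu X).
exists (fun X => fmap B (repl_map X) ∘ inv_iso (Bu X) ∘ t (R' X)
  ∘ fmap A (u X) ∘ inv_iso (Aq X)); split=> [X Y f|X]; last first.
  by do !apply: iso_comp; rewrite ?(t_iso _) //; apply: iso_inv.
have [g qg] : exists g, repl_map Y ∘ g = f ∘ repl_map X.
  exact: cofibrant_lift (repl_cofibrant X) (repl_fib Y) (repl_weq Y).
have [_ cr wr] := RP X.
have [h hr] := fibrant_extend (fib_repl_map (F (repl Y)) ∘ fmap F g)
  (svalP (R' Y)) cr wr.
have uN : u Y ∘ g = fmap G h ∘ u X by rewrite -adj_post -adj_pre hr.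
have Aq_square : inv_iso (Aq Y) ∘ fmap A f = fmap A g ∘ inv_iso (Aq X).
  by apply: inv_iso_natural; rewrite -!fmapM qg.
have Au_square : fmap A (u Y) ∘ fmap A g = fmap A (fmap G h) ∘ fmap A (u X).
  by rewrite -!fmapM uN.
have Bu_square : inv_iso (Bu Y) ∘ fmap B (fmap G h) = fmap B g ∘ inv_iso (Bu X).
  by apply: inv_iso_natural; rewrite -!fmapM uN.
have Bq_square : fmap B (repl_map Y) ∘ fmap B g = fmap B f ∘ fmap B (repl_map X).
  by rewrite -!fmapM qg.
apply: square_paste Aq_square; apply: square_paste Au_square.
apply: square_paste (tN (R' X) (R' Y) h).
exact: square_paste Bq_square Bu_square.
Qed.

(** With [K1] an extension of [K] to [E], the functor [N] extends the composite of
[K1] and [F] from cofibrant objects to [M]. For [Y] fibrant and [q] a cofibrant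
replacement of [G Y] by [Q], the isomorphisms [N (G Y) <- N Q -> K1 (F Q) -> K1 Y]
compare [N G] with [K], the last one being the image of the homotopy counit. *)
Lemma coreflection_extend (D : category) (K : functor Ef D) :
  inverts (preimage_class Gf (@weq M)) K ->
  exists2 N : functor M D, inverts (@weq M) N
    & naturally_isomorphic (comp_functor N Gf) K.
Proof.
move=> KW.
have [|K1 K1W K1K] := @extend_from_fibrant _ _ K.
  move=> X Y f wf; apply: KW.
  exact: (ken_brown_right aQ (svalP X) (svalP Y) wf).
pose H := comp_functor K1 (comp_functor F (incl (@cofibrant M))).
have [|N NW [s [sN s_iso]]] := @extend_from_cofibrant _ _ H.
  move=> X Y f wf; apply: K1W.
  exact: (ken_brown aQ (svalP X) (svalP Y) wf).
exists N => //.
apply: (natiso_trans _ K1K).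
pose Q X : full_sub (@cofibrant M) := repl_sub (Gf X).
pose q X : hom (sval (Q X)) (Gf X) := repl_map (Gf X).
pose v (X : Ef) : hom (F (sval (Q X))) (sval X) := adj_inv a (q X).
have Nq_iso X : is_iso (fmap N (q X)) by apply: NW; apply: repl_weq.
have [k [kN k_iso]] := K1K.
(* on fibrant objects [K1] agrees with [K], so it inverts what [K] inverts *)
have K1W' (X Y : Ef) (f : hom X Y) : weq (fmap Gf f) ->
    is_iso (@fmap _ _ K1 (sval X) (sval Y) f).
  move=> wf; have kf := kN _ _ f; rewrite /= in kf.
  have kf_iso : is_iso (k Y ∘ @fmap _ _ K1 (sval X) (sval Y) f).
    by rewrite kf; apply: iso_comp; [exact: KW | exact: k_iso].
  have -> : @fmap _ _ K1 (sval X) (sval Y) f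
      = inv_iso (k_iso Y) ∘ (k Y ∘ @fmap _ _ K1 (sval X) (sval Y) f).
    by rewrite compcA inv_isoK comp1c.
  by apply: iso_comp => //; apply: iso_inv.
(* The source of the counit [v X] need not be fibrant, so [v X] is extended to a
   map [w] on a fibrant replacement [r] of it. Now [G w] composed with the
   homotopy unit [adj a r] is the replacement [q X], so [G w] is a weak
   equivalence. *)
have v_iso X : is_iso (fmap K1 (v X)).
  have [fR cr wr] := fib_repl_mapP (F (sval (Q X))).
  have [w wrv] := fibrant_extend (v X) (svalP X) cr wr.
  have wu : weq (adj a (fib_repl_map (F (sval (Q X))))).
    by apply: unit_weq; split; [exact: repl_cofibrant | exists (fib_repl_map _)].
  rewrite -wrv fmapM; apply: iso_comp; last exact: K1W.
  apply: (K1W' (exist _ _ fR) X w); apply: (weq_cancelr wu).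
  by rewrite /= -adj_post wrv adj_invK; apply: repl_weq.
exists (fun X => fmap K1 (v X) ∘ s (Q X) ∘ inv_iso (Nq_iso X)).
split=> [X Y f|X]; last first.
  apply: iso_comp; last exact: iso_inv.
  by apply: iso_comp; [exact: v_iso | exact: s_iso].
have [g qg] : exists g, q Y ∘ g = fmap Gf f ∘ q X.
  exact: cofibrant_lift (repl_cofibrant _) (repl_fib _) (repl_weq _).
have vN : v Y ∘ fmap F g = (f : hom (sval X) (sval Y)) ∘ v X.
  by apply: (adj_inj (a := a)); rewrite adj_pre adj_post !adj_invK.
have v_square : fmap K1 (v Y) ∘ fmap K1 (fmap F g) = fmap K1 f ∘ fmap K1 (v X).
  by rewrite -!fmapM vN.
have q_square : inv_iso (Nq_iso Y) ∘ fmap N (fmap Gf f)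
    = fmap N g ∘ inv_iso (Nq_iso X).
  by apply: inv_iso_natural; rewrite -!fmapM qg.
exact: square_paste (square_paste v_square (sN (Q X) (Q Y) g)) q_square.
Qed.

Lemma coreflection_localization (L : category) (g : functor M L) :
  is_localization (@weq M) g ->
  is_localization (preimage_class Gf (@weq M)) (comp_functor g Gf).
Proof.
move=> lg; split.
- by move=> X Y f wf; apply: (loc_inverts lg wf).
- move=> D K /coreflection_extend[N NW NK].
  have [N' N'N] := loc_extend lg NW; exists N'.
  exact: (natiso_trans (natiso_pre Gf N'N) NK).
- move=> D A B AB; apply: (loc_unique lg).
  have inv (K : functor L D) : inverts (@weq M) (comp_functor K g) :=
    inverts_comp K (loc_inverts lg).
  exact: (coreflection_unique (inv A) (inv B) AB).
Qed.

End Coreflection.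

(** * Factorisations of Quillen functors *)

(** A factorisation holds only up to natural isomorphism, and isomorphisms are
weak equivalences. *)
Lemma weq_natural (C : category) (M : model_category) (F G : functor C M)
    (X Y : C) (f : hom X Y) :
  naturally_isomorphic F G -> weq (fmap F f) -> weq (fmap G f).
Proof.
move=> [t [tN t_iso]] wf; apply: (weq_cancelr (weq_iso (t_iso X))).
by rewrite -tN; apply: weq_comp wf; apply: weq_iso.
Qed.

Lemma coreflection_fibrant (E M : model_category) (G : functor E M) (X : E) :
  homotopy_coreflection G -> fibrant X -> fibrant (G X).
Proof. by move=> [F [a [aQ _]]]; exact: (right_quillen_fibrant aQ). Qed.

Lemma image_factorisation_weq (E' E : model_category) (G : functor E' E)
    (fac : image_factorisation G) (X Y : E') (f : hom X Y) :
  fibrant X -> fibrant Y -> (weq (fmap (image_fst fac) f) <-> weq (fmap G f)).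
Proof.
case: fac => M G1 G2 G1c _ G2c G21 fX fY /=.
rewrite (G2c _ _ (fmap G1 f) (coreflection_fibrant G1c fX) (coreflection_fibrant G1c fY)).
split; first exact: (weq_natural (f := f) G21).
exact: (weq_natural (f := f) (natiso_sym G21)).
Qed.

Lemma image_factorisation_localization (E' E : model_category)
    (G : functor E' E) (fac : image_factorisation G) (L : category)
    (g : functor (image_obj fac) L) :
  is_localization (@weq (image_obj fac)) g ->
  is_localization (preimage_class (comp_functor G (incl (@fibrant E'))) (@weq E))
    (comp_functor g (comp_functor (image_fst fac) (incl (@fibrant E')))).
Proof.
move=> lg; have [F [a [aQ unit_weq]]] := image_fst_coreflection fac.
have -> : preimage_class (comp_functor G (incl (@fibrant E'))) (@weq E)
    = preimage_class (comp_functor (image_fst fac) (incl (@fibrant E')))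
        (@weq (image_obj fac)).
  apply/functional_extensionality_dep => X; apply/functional_extensionality_dep => Y.
  apply/functional_extensionality_dep => f; apply/propext.
  exact: (iff_sym (@image_factorisation_weq _ _ _ fac _ _ f (svalP X) (svalP Y))).
exact: coreflection_localization aQ unit_weq _ _ lg.
Qed.

Lemma right_quillen_op (E E' : model_category) (F : functor E E') :
  left_quillen F -> @right_quillen (op_model E') (op_model E) (op_functor F).
Proof.
move=> [G [a aQ]]; exists (op_functor G), (op_adjunction a).
exact: quillen_adjunction_op.
Qed.

Lemma right_conservative_op (E E' : model_category) (F : functor E E') :
  homotopy_left_conservative F ->
  @homotopy_right_conservative (op_model E') (op_model E) (op_functor F).
Proof. by move=> Fc X Y f /fibrant_op fX /fibrant_op fY; apply: Fc. Qed.

Definition image_of_coimage (E E' : model_category) (F : functor E E')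
    (fac : coimage_factorisation F) :
    @image_factorisation (op_model E) (op_model E') (op_functor F) :=
  @ImageFactorisation (op_model E) (op_model E') (op_functor F)
    (op_model (coimage_obj fac)) (op_functor (coimage_fst fac))
    (op_functor (coimage_snd fac))
    (coreflection_op (coimage_fst_reflection fac))
    (right_quillen_op (coimage_snd_quillen fac))
    (right_conservative_op (@coimage_snd_conservative _ _ _ fac))
    (natiso_op (coimage_comp fac)).

Theorem proposition1p8 :
  (forall (E' E : model_category) (G : functor E' E), right_quillen G ->
     forall fac1 fac2 : image_factorisation G,
       equivalent_categories (derived_image fac1) (derived_image fac2)) /\
  (forall (E E' : model_category) (F : functor E E'), left_quillen F ->
     forall fac1 fac2 : coimage_factorisation F,
       equivalent_categories (derived_coimage fac1) (derived_coimage fac2)).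
Proof.
split=> [E' E G _ fac1 fac2|E E' F _ fac1 fac2].
  exact: localizations_equivalent
    (image_factorisation_localization (ho_localization (image_obj fac1)))
    (image_factorisation_localization (ho_localization (image_obj fac2))).
apply: equivalent_unop.
apply: localizations_equivalent.
  apply: (image_factorisation_localization (fac := image_of_coimage fac1)).
  exact: (localization_op (ho_localization (coimage_obj fac1))).
apply: (image_factorisation_localization (fac := image_of_coimage fac2)).
exact: (localization_op (ho_localization (coimage_obj fac2))).
Qed.
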